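(* Let $T>0$. Let $\theta:[0,T]\to(0,\infty)$ and $\eta:[0,T]\to(0,\infty)$ be continuous, and assume that $\theta$ is strictly decreasing. For each $N\in\mathbb{N}$ set $\Delta t=T/N$, $t_i=i\Delta t$ for $i=0,\dots,N$, and $$\theta_i^{(N)}=\theta(t_{i-1}),\qquad \eta_i^{(N)}=\frac{\eta(t_{i-1})}{\Delta t},\qquad i=1,\dots,N.$$ Let $A^{(N)}=(a^{(N)}_{ij})_{1\le i,j\le N}$ be the matrix with $a^{(N)}_{ii}=2\eta_i^{(N)}$ and $a^{(N)}_{ij}=\theta^{(N)}_{\min(i,j)}$ for $i\ne j$. Assume that for every $N$ the matrix $A^{(N)}$ is a $B$-matrix. Then for every $t\in[0,T]$, $$\frac{2}{T}\eta(t)+\frac1T\int_0^t\theta(u)\,du+\Bigl(1-\frac tT\Bigr)\theta(t)\;\ge\;\theta(0).$$ If, in addition, $\theta\in C^1([0,T])$, then this inequality can be rewritten as $$2\,\eta(t)\;\ge\;\int_0^t(T-s)\,(-\dot\theta(s))\,ds,\qquad\forall t\in[0,T].$$ In particular, at terminal time, $$2\,\eta(T)\;\ge\;\int_0^T(T-s)\,(-\dot\theta(s))\,ds=T\theta(0)-\int_0^T\theta(u)\,du .$$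
   Context: A real $N\times N$ matrix $A=(a_{i,k})$ is a $B$-matrix if for all $i=1,\dots,N$: $\sum_{k=1}^N a_{i,k}>0$ and $\frac1N\sum_{k=1}^N a_{i,k}>a_{i,j}$ for all $j\ne i$. A dot denotes the derivative in time. *)

(* Defs.v *)
From HB Require Import structures.
From mathcomp Require Import all_boot all_order all_algebra.
From mathcomp Require Import all_classical all_reals all_analysis.
Import Order.TTheory GRing.Theory Num.Theory.
Import numFieldNormedType.Exports.

Set Implicit Arguments.
Unset Strict Implicit.
Unset Printing Implicit Defensive.

Local Open Scope classical_set_scope.
Local Open Scope ring_scope.

Definition B_matrix (R : realType) (N : nat) (A : 'M[R]_N) : Prop :=
  forall i : 'I_N,
    0 < \sum_(k < N) A i k /\
    forall j : 'I_N, j != i -> A i j < N%:R^-1 * \sum_(k < N) A i k.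

Definition time_step (R : realType) (T : R) (N : nat) : R := T / N%:R.

Definition grid (R : realType) (T : R) (N i : nat) : R :=
  i%:R * time_step T N.

(* [theta_seq] and [eta_seq] are meant for indices 1 <= i <= N. *)
Definition theta_seq (R : realType) (T : R) (theta : R -> R) (N i : nat) : R :=
  theta (grid T N i.-1).

Definition eta_seq (R : realType) (T : R) (eta : R -> R) (N i : nat) : R :=
  eta (grid T N i.-1) / time_step T N.

(* 'I_N starts at 0, so [i : 'I_N] stands for the 1-based index [i.+1]. *)
Definition A_mx (R : realType) (T : R) (theta eta : R -> R) (N : nat)
    : 'M[R]_N :=
  \matrix_(i < N, j < N)
    if i == j then 2 * eta_seq T eta N i.+1
    else theta_seq T theta N (minn i.+1 j.+1).

(* f is C^1 on the closed interval [a, b], with derivative df there.  The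
   difference quotients only use points of [a, b], so the derivatives at a and
   b are one-sided and the values of f outside [a, b] play no role. *)
Definition C1_with_derivative (R : realType) (a b : R) (f df : R -> R) : Prop :=
  (forall t : R, t \in `[a, b] ->
     (f s - f t) / (s - t) @[s --> within [set` `[a, b]] t^'] --> df t) /\
  {within `[a, b], continuous df}.

(* Main.v *)
(* With i = m + 1 and j = 1 the B-matrix condition reads
     theta(0) < (1/N) (sum_(k<m) theta(t_k) + (N-m-1) theta(t_m)) + (2/T) eta(t_m),
   where T/N times the sum, a left Riemann sum of the decreasing theta, exceeds
   the corresponding right sum, which is at most the integral of theta over
   [0, t_m], by no more than theta(0) T/N.  So the claimed
   inequality holds at t = (m/N) T up to the error theta(0)/N; since a rational
   m/N is also km/kN for all k >= 1, the error vanishes on rational multiples of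
   T, and continuity extends the inequality to [0, T].  The C^1 form is an
   integration by parts. *)
Require Import Defs.
From HB Require Import structures.
From mathcomp Require Import all_boot all_order all_algebra.
From mathcomp Require Import all_classical all_reals all_analysis.
From mathcomp Require Import ring lra.
Import Order.TTheory GRing.Theory Num.Theory.
Import numFieldNormedType.Exports.
Set Implicit Arguments.
Unset Strict Implicit.

Local Open Scope classical_set_scope.
Local Open Scope ring_scope.

(** * Row inequality and Riemann sums at the grid points *)

Lemma B_matrix_row_bound (R : realType) (T : R) (theta eta : R -> R) (N m : nat) :
  (0 < m < N)%N -> B_matrix (A_mx T theta eta N) ->
  theta 0 < N%:R^-1 * (\sum_(0 <= k < m) theta (grid T N k)
                       + 2 * eta_seq T eta N m.+1
                       + (N%:R - m.+1%:R) * theta (grid T N m)).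
Proof.
(* Zero-based indices: row [m] is tested against column 0, which is off the diagonal because [0 < m]
   and whose entry is [theta 0]. *)
move=> /andP[m0 mN] /(_ (Ordinal mN))[_ /(_ (Ordinal (ltn_trans m0 mN)))].
rewrite -val_eqE /= eq_sym -lt0n => /(_ m0).
rewrite mxE -val_eqE /= gtn_eqF// /theta_seq minnSS minn0 /= /grid mul0r -/(grid T N).
under eq_bigr do rewrite mxE -val_eqE /= minnSS /=.
rewrite -(big_mkord xpredT (fun k => if m == k then 2 * eta_seq T eta N m.+1
  else theta (grid T N (minn m k)))).
(* Entries depend on the smaller index only, so the diagonal splits the row: columns k < m carry
   theta(t_k), and the N - m - 1 columns after it all carry theta(t_m). *)
rewrite (big_cat_nat (n := m)) 1?ltnW//= (big_ltn mN) eqxx addrA.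
move=> /lt_le_trans; apply.
rewrite le_eqVlt; apply/predU1P; left; congr (_ * (_ + _ + _)).
  by apply: eq_big_nat => k /andP[_ km]; rewrite gtn_eqF// (minn_idPr (ltnW km)).
under eq_big_nat => k /andP[mk _].
  rewrite ltn_eqF// (minn_idPl (ltnW mk)); over.
by rewrite sumr_const_nat -natrB// [RHS]mulr_natl.
Qed.

Lemma continuous_within_integrable (R : realType) (f : R -> R) (a b : R) :
  {within `[a, b], continuous f} ->
  lebesgue_measure.-integrable `[a, b] (EFin \o f).
Proof.
move=> cf; apply: continuous_compact_integrable => //.
exact: segment_compact.
Qed.

(** Induction on the number of cells: on each cell []m * d, (m + 1) * d]] a decreasing [f] is at
    least its value at the right endpoint, so the integral dominates that constant. *)
Lemma right_sum_le_Rintegral (R : realType) (f : R -> R) (b d : R) (m : nat) :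
  0 <= d -> m%:R * d <= b ->
  {within `[0, b], continuous f} ->
  {in `[0, b] &, forall s t, s <= t -> f t <= f s} ->
  d * \sum_(0 <= k < m) f (k.+1%:R * d)
    <= \int[lebesgue_measure]_(u in `[0, m%:R * d]) f u.
Proof.
move=> d0 + cf df; elim: m => [|m IH] mb.
  by rewrite big_geq// mulr0 mul0r set_itv1 Rintegral_set1.
have md0 : 0 <= m%:R * d by rewrite mulr_ge0.
have mdS : m%:R * d <= m.+1%:R * d by rewrite ler_wpM2r// ler_nat.
have iS : lebesgue_measure.-integrable `[0, m.+1%:R * d] (EFin \o f).
  apply: continuous_within_integrable; apply: continuous_subspaceW cf.
  by apply: subset_itvl; rewrite bnd_simp.
have iL : lebesgue_measure.-integrable `]m%:R * d, m.+1%:R * d] (EFin \o f).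
  apply: integrableS iS => //.
  by apply: subset_itvr; rewrite bnd_simp.
rewrite big_nat_recr//= mulrDr -[leRHS](subrK
  (\int[lebesgue_measure]_(u in `[0, m%:R * d]) f u)).
rewrite Rintegral_itvB ?bnd_simp// addrC lerD//; last first.
  by apply: IH; exact: le_trans mb.
have -> : d * f (m.+1%:R * d) = \int[lebesgue_measure]_(u in
    `]m%:R * d, m.+1%:R * d]) f (m.+1%:R * d).
  rewrite Rintegral_cst//= lebesgue_measure_itv/= lte_fin.
  case: ltP => [_|h].
    by rewrite EFinN -EFinB /= -mulrBl -natrB// subSnn mul1r mulrC.
  (* The measure of the cell is computed by cases; if its endpoints are not strictly ordered, the
     cell is empty and [d] must vanish. *)
  suff -> : d = 0 by rewrite mul0r mulr0.
  by apply/eqP; rewrite eq_le d0 andbT -[d]mul1r -[1](_ : m.+1%:R - m%:R = 1)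
    ?mulrBl ?subr_le0// -natrB// subSnn.
apply: le_Rintegral => //.
  apply/integrableP; split; first exact: measurable_cst.
  rewrite integral_cst//= lebesgue_measure_itv/=.
  by case: ifP => _; rewrite ?mule0// -EFinB -EFinM ltry.
move=> x /=; rewrite in_itv/= => /andP[x1 x2].
apply: df => //; rewrite in_itv/= ?mb ?(le_trans md0 mdS)//.
by rewrite (le_trans md0 (ltW x1)) (le_trans x2 mb).
Qed.

(* The limit of the mean of the matrix row at time t as N goes to infinity. *)
Definition limit_row (R : realType) (T : R) (theta eta : R -> R) (t : R) : R :=
  2 / T * eta t + T^-1 * \int[lebesgue_measure]_(u in `[0, t]) theta u
    + (1 - t / T) * theta t.

Lemma limit_row_grid_ge (R : realType) (T : R) (theta eta : R -> R) (N m : nat) :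
  0 < T ->
  {within `[0, T], continuous theta} ->
  {in `[0, T] &, forall s t, s <= t -> theta t <= theta s} ->
  (forall t, t \in `[0, T] -> 0 <= theta t) ->
  (0 < m < N)%N -> B_matrix (A_mx T theta eta N) ->
  theta 0 - N%:R^-1 * theta 0 <= limit_row T theta eta (grid T N m).
Proof.
move=> T0 ct dt t0 mN AB.
have N0 : 0 < N%:R :> R by rewrite ltr0n; case/andP: mN => /ltn_trans; apply.
have d0 : 0 <= time_step T N by rewrite divr_ge0 ?ltW.
have mT : grid T N m <= T.
  rewrite /grid /time_step mulrA ler_pdivrMr// mulrC ler_pM2l// ler_nat.
  by case/andP: mN => _ /ltnW.
have g0 : 0 <= grid T N m by rewrite mulr_ge0.
have := B_matrix_row_bound mN AB.
have := right_sum_le_Rintegral d0 mT ct dt.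
rewrite -/(grid T N m); set I := \int[_]_(_ in _) _ => sumI.
(* Telescoping turns the left Riemann sum into the right one; the boundary term [theta 0] is the
   source of the error [N%:R^-1 * theta 0]. *)
have -> : \sum_(0 <= k < m) theta (grid T N k) =
    theta 0 - theta (grid T N m) + \sum_(0 <= k < m) theta (k.+1%:R * time_step T N).
  have := telescope_sumr (fun k => theta (grid T N k)) (leq0n m).
  by rewrite sumrB /grid mul0r => /eqP; rewrite subr_eq => /eqP ->; ring.
set S := \sum_(_ <= k < m) _ in sumI *.
rewrite /limit_row -/I /eta_seq /=.
set x := grid T N m; set D := time_step T N in sumI *.
set n : R := N%:R in N0 *.
have tx : 0 <= n^-1 * theta x.
  by apply: mulr_ge0; [rewrite invr_ge0 ltW|rewrite t0// in_itv/= g0].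
have TI : T^-1 * (D * S) <= T^-1 * I by rewrite ler_pM2l ?invr_gt0.
have -> : n^-1 * (theta 0 - theta x + S + 2 * (eta x / D)
      + (n - m.+1%:R) * theta x) =
    n^-1 * theta 0 + T^-1 * (D * S) + 2 / T * eta x
      + (1 - x / T) * theta x - 2 * (n^-1 * theta x).
  rewrite /x /grid /D /time_step -/n -natr1.
  by field; rewrite !gt_eqF.
lra.
Qed.

(** * From grid points to the whole interval *)

Lemma continuous_limit_row (R : realType) (T : R) (theta eta : R -> R) :
  0 < T ->
  {within `[0, T], continuous theta} -> {within `[0, T], continuous eta} ->
  {within `[0, T], continuous (limit_row T theta eta)}.
Proof.
move=> T0 ct ce.
have cI : {within `[0, T], continuous
    (fun t => \int[lebesgue_measure]_(u in `[0, t]) theta u)}.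
  apply: parameterized_integral_continuous; first exact: ltW.
  exact: continuous_within_integrable.
have cl : {within `[0, T], continuous (fun t : R => 1 - t / T)}.
  apply: continuous_subspaceT => x; apply: cvgB; first exact: cvg_cst.
  by apply: cvgM; [exact: cvg_id|exact: cvg_cst].
move=> x; apply: cvgD; last by apply: cvgM; [exact: cl|exact: ct].
by apply: cvgD; apply: cvgM; [exact: cvg_cst|exact: ce|exact: cvg_cst|exact: cI].
Qed.

Lemma rat_itv01_frac (q : rat) : 0 < q -> q < 1 ->
  exists m n : nat, (0 < m < n)%N /\ q = m%:R / n%:R.
Proof.
move=> q0 q1; exists `|numq q|%N, `|denq q|%N.
have Eq : q = `|numq q|%:R / `|denq q|%:R.
  by rewrite -[LHS]divq_num_den !natr_absz !ger0_norm// numq_ge0 ltW.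
have d0 : (0 < `|denq q|)%N by rewrite absz_gt0.
split=> //; rewrite absz_gt0 numq_eq0 gt_eqF//=.
by move: q1; rewrite {1}Eq ltr_pdivrMr ?ltr0n// mul1r ltr_nat.
Qed.

(** If [F t < c], continuity keeps [F] below [c] on a neighbourhood of [t] in [0, T], and such a
    neighbourhood contains some [ratr q * T] with 0 < q < 1. *)
Lemma le_of_rational_dense (R : realType) (T c : R) (F : R -> R) :
  0 < T -> {within `[0, T], continuous F} ->
  (forall q : rat, 0 < q -> q < 1 -> c <= F (ratr q * T)) ->
  forall t, t \in `[0, T] -> c <= F t.
Proof.
move=> T0 cF Fq t tT; rewrite leNgt; apply/negP => Ftc.
move/subspace_continuousP : cF => /(_ t tT) /cvgrPdist_lt /(_ (c - F t)).
rewrite subr_gt0 => /(_ Ftc).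
rewrite near_withinE => -[e /= e0 He].
move: tT; rewrite in_itv /= => /andP[t0 tT].
(* The neighbourhood is clipped to ]0, T[ so that [q] lies strictly between 0 and 1; it stays
   nonempty even when [t] is 0 or T. *)
have : Num.max 0 (t - e) / T < Num.min T (t + e) / T.
  rewrite ltr_pM2r ?invr_gt0// lt_min !gt_max T0/=.
  by rewrite ?(ltr_wpDl t0 e0) ?addr_gt0//; apply/and3P; split; lra.
move=> /rat_in_itvoo[q]; rewrite in_itv/= ltr_pdivrMr// ltr_pdivlMr//.
rewrite gt_max lt_min -andbA => /and4P[q0 q1 q2 q3].
have q0' : 0 < q by move: q0; rewrite pmulr_lgt0// ltr0q.
have q1' : q < 1 by rewrite -(ltr_rat R) rmorph1 -(ltr_pM2r T0) mul1r.
have := He (ratr q * T).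
rewrite /ball/= ltr_distlC in_itv/= q1 q3 (ltW q0) (ltW q2) => /(_ isT isT).
by have := Fq _ q0' q1'; rewrite /from_subspace => ?; rewrite ltr_norml; lra.
Qed.

Lemma limit_row_rational_ge (R : realType) (T : R) (theta eta : R -> R) (q : rat) :
  0 < T ->
  {within `[0, T], continuous theta} ->
  {in `[0, T] &, forall s t, s <= t -> theta t <= theta s} ->
  (forall t, t \in `[0, T] -> 0 <= theta t) ->
  (forall N : nat, (0 < N)%N -> B_matrix (A_mx T theta eta N)) ->
  0 < q -> q < 1 -> theta 0 <= limit_row T theta eta (ratr q * T).
Proof.
move=> T0 ct dt t0 AB /rat_itv01_frac h /h[m [n [mn ->]]].
have n0 : (0 < n)%N by case/andP: mn => /ltn_trans; apply.
apply/ler_addgt0Pr => e e0.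
(* This [k] exceeds [theta 0 / e], so on the grid with k * n steps, where (m/n) T has index k * m,
   the error theta(0)/(k n) is at most [e]. *)
set k := (Num.truncn (theta 0 / e)).+1.
have kn0 : (0 < k * n)%N by rewrite muln_gt0.
have kmn : (0 < k * m < k * n)%N by rewrite muln_gt0 ltn_pmul2l.
have := limit_row_grid_ge T0 ct dt t0 kmn (AB _ kn0).
have -> : grid T (k * n) (k * m) = ratr (m%:R / n%:R) * T.
  rewrite /grid /time_step fmorph_div !rmorph_nat !natrM.
  by field; rewrite ?pnatr_eq0 -?lt0n n0.
have th0 : 0 <= theta 0 by apply: t0; rewrite in_itv/= lexx ltW.
suff : (k * n)%:R^-1 * theta 0 <= e by lra.
rewrite mulrC ler_pdivrMr ?ltr0n// mulrC -ler_pdivrMr//.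
apply: (@le_trans _ _ k%:R); first exact/ltW/truncnS_gt.
by rewrite ler_nat leq_pmulr.
Qed.

(** * The C^1 form *)

Lemma C1_with_derivative_is_derive (R : realType) (a b x : R) (f df : R -> R) :
  C1_with_derivative a b f df -> x \in `]a, b[ -> is_derive x 1 f (df x).
Proof.
move=> [fD _] xab; have xcc := subset_itv_oo_cc xab.
have fx : h^-1 *: ((f \o shift x) (h *: (1 : R)) - f x) @[h --> 0^'] --> df x.
  apply/cvgrPdist_lt => e e0.
  have /cvgrPdist_lt /(_ _ e0) := fD x xcc.
  rewrite near_withinE => -[d /= d0 Hd].
  move: xab; rewrite in_itv/= => /andP[ax xb].
  have D0 : 0 < Num.min d (Num.min (x - a) (b - x)).
    by rewrite !lt_min d0 !subr_gt0 ax.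
  (* The radius is capped by the distances to [a] and [b], so x + h stays in [a, b], where the
     one-sided hypothesis applies with s = x + h. *)
  exists (Num.min d (Num.min (x - a) (b - x))) => //= h.
  rewrite /ball/= sub0r normrN !lt_min => /and3P[hd ha hb] h0.
  have := Hd (h%:A + x).
  have -> : h%:A + x = x + h by rewrite [_%:A]mulr1 addrC.
  rewrite /ball/= opprD addNKr normrN -subr_eq0 addrC addKr.
  rewrite in_itv/= => /(_ hd h0) H.
  rewrite /GRing.scale/= mulrC; apply: H.
  by move: ha hb; rewrite !ltr_norml => /andP[? _] /andP[_ ?]; lra.
apply: DeriveDef; first by apply/cvg_ex; exists (df x).
exact/cvg_lim.
Qed.

Lemma Rintegral_by_parts_affine (R : realType) (T t : R) (f df : R -> R) :
  t \in `[0, T] -> {within `[0, T], continuous f} ->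
  C1_with_derivative 0 T f df ->
  \int[lebesgue_measure]_(s in `[0, t]) ((T - s) * (- df s)) =
  T * f 0 - (T - t) * f t - \int[lebesgue_measure]_(s in `[0, t]) f s.
Proof.
(* At t = 0 both sides vanish; this case is treated apart because integration by parts is applied on
   an interval with distinct endpoints. *)
rewrite in_itv/= => /andP[]; rewrite le_eqVlt => /predU1P[<- _ _ _|t0 tT cf fC1].
  by rewrite set_itv1 !Rintegral_set1 !subr0 subrr.
have sub : `[0, t] `<=` `[0, T] by apply: subset_itvl; rewrite bnd_simp.
have /(continuous_within_itvP _ t0)[_ cf0 cft] := continuous_subspaceW sub cf.
have dfx x : x \in `]0, t[ -> is_derive x 1 f (df x).
  rewrite in_itv/= => /andP[x0 xt].
  apply: (C1_with_derivative_is_derive fC1).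
  by rewrite in_itv/= x0 (lt_le_trans xt).
(* The factors are T - s, with derivative -1, and -f, with derivative -df: the remaining integrand
   is (-1)(-f) = f, and the boundary terms give T f(0) - (T - t) f(t). *)
rewrite (@Rintegration_by_parts _ (fun s => T - s) (- f) (cst (-1)) (- df))//.
- under eq_Rintegral do rewrite /cst/= mulrNN mul1r.
  by rewrite fctE subr0; ring.
- by apply: continuous_subspaceT => x; exact: cvg_cst.
- split=> [x _||]; first exact: derivableB.
  + by apply: cvgB; [exact: cvg_cst|apply: cvg_at_right_filter; exact: cvg_id].
  + by apply: cvgB; [exact: cvg_cst|apply: cvg_at_left_filter; exact: cvg_id].
- by move=> x _; rewrite derive1E deriveB// derive_cst derive_id sub0r.
- have cdf := continuous_subspaceW sub fC1.2.
  by move=> x; apply: cvgN; exact: cdf.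
- split=> [x xt||].
  + by apply: derivableN; have [] := dfx _ xt.
  + exact: cvgN.
  + exact: cvgN.
- by move=> x xt; rewrite derive1E; have ? := dfx _ xt; rewrite deriveN// derive_val.
Qed.

Theorem proposition6 (R : realType) (T : R) (T_gt0 : 0 < T)
    (theta eta : R -> R)
    (theta_gt0 : forall t : R, t \in `[0, T] -> 0 < theta t)
    (eta_gt0 : forall t : R, t \in `[0, T] -> 0 < eta t)
    (theta_cont : {within `[0, T], continuous theta})
    (eta_cont : {within `[0, T], continuous eta})
    (theta_decr : forall s t : R, s \in `[0, T] -> t \in `[0, T] ->
       s < t -> theta t < theta s)
    (A_B_matrix : forall N : nat, (0 < N)%N ->
       B_matrix (A_mx T theta eta N)) :
  (forall t : R, t \in `[0, T] ->
     2 / T * eta t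
       + T^-1 * \int[lebesgue_measure]_(u in `[0, t]) theta u
       + (1 - t / T) * theta t >= theta 0) /\
  (forall dtheta : R -> R, C1_with_derivative 0 T theta dtheta ->
     [/\ forall t : R, t \in `[0, T] ->
           (2 / T * eta t
              + T^-1 * \int[lebesgue_measure]_(u in `[0, t]) theta u
              + (1 - t / T) * theta t >= theta 0
            <->
            2 * eta t >=
              \int[lebesgue_measure]_(s in `[0, t]) ((T - s) * (- dtheta s))),
         forall t : R, t \in `[0, T] ->
           2 * eta t >=
             \int[lebesgue_measure]_(s in `[0, t]) ((T - s) * (- dtheta s)),
         2 * eta T >=
           \int[lebesgue_measure]_(s in `[0, T]) ((T - s) * (- dtheta s)) &
         \int[lebesgue_measure]_(s in `[0, T]) ((T - s) * (- dtheta s)) =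
           T * theta 0 - \int[lebesgue_measure]_(u in `[0, T]) theta u]).
Proof.
have anti : {in `[0, T] &, forall s t, s <= t -> theta t <= theta s}.
  move=> s t s0 t0; rewrite le_eqVlt => /predU1P[->//|st].
  exact/ltW/theta_decr.
have row_ge t : t \in `[0, T] -> theta 0 <= limit_row T theta eta t.
  apply: le_of_rational_dense => //; first exact: continuous_limit_row.
  by move=> q; apply: limit_row_rational_ge => // s /theta_gt0/ltW.
split=> [|dtheta C1]; first exact: row_ge.
have TT : T \in `[0, T] by rewrite in_itv/= lexx ltW.
have rewritten t : t \in `[0, T] ->
    (theta 0 <= limit_row T theta eta t) =
    (\int[lebesgue_measure]_(s in `[0, t]) ((T - s) * (- dtheta s))
       <= 2 * eta t).
  move=> tT; rewrite (Rintegral_by_parts_affine tT theta_cont C1).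
  (* After multiplication by T, both inequalities say T theta(0) <= 2 eta(t) + I + (T - t) theta(t),
     with I the integral of theta over [0, t]. *)
  rewrite -(ler_pM2l T_gt0) /limit_row.
  set I := \int[_]_(_ in _) _.
  have -> : T * (2 / T * eta t + T^-1 * I + (1 - t / T) * theta t) =
      2 * eta t + I + (T - t) * theta t by field; rewrite gt_eqF.
  by apply/idP/idP; lra.
have integral_le t : t \in `[0, T] ->
    \int[lebesgue_measure]_(s in `[0, t]) ((T - s) * (- dtheta s)) <= 2 * eta t.
  by move=> tT; rewrite -rewritten// row_ge.
split=> [t tT|||].
- by rewrite -/(limit_row T theta eta t) rewritten.
- exact: integral_le.
- exact: integral_le.
- by rewrite (Rintegral_by_parts_affine TT theta_cont C1) subrr mul0r subr0.
Qed.
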